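(* Let $(\xi_i)_{i\ge1}$ be a sequence of algebraic integers and let $\mathcal{O}_0$ be a ring, containing $1$, of algebraic integers. For $i\ge1$ put $\mathcal{O}_i=\mathcal{O}_0[\xi_1,\ldots,\xi_i]$, and let $\mathcal{O}=\bigcup_{i\ge1}\mathcal{O}_i=\mathcal{O}_0[\xi_1,\xi_2,\xi_3,\ldots]$. For $i\ge 0$ let $K_i\subset\overline{\mathbb{Q}}$ be the field of fractions of $\mathcal{O}_i$, and for $i\ge1$ set $d_i=[K_{i-1}(\xi_i):K_{i-1}]$. Suppose that for all $i\in\mathbb{N}$: $\mathcal{N}_{\mathrm{house}}(\mathcal{O}_i)=\infty$, $d_i>1$, and $M_{\xi_i,K_{i-1}}\in\mathcal{O}_{i-1}[x]$. Then $$\mathcal{N}_{\mathrm{house}}(\mathcal{O})\ge\liminf_{i\to\infty}\eta(K_{i-1},\xi_i),$$ where the $\liminf$ is taken in $\mathbb{R}\cup\{\pm\infty\}$.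
   Context: $\mathbb{N}=\{1,2,3,\ldots\}$. The house $\overline{|\alpha|}$ of $\alpha\in\overline{\mathbb{Q}}$ is the maximum of the complex absolute values of the conjugates of $\alpha$ over $\mathbb{Q}$. For $S\subset\overline{\mathbb{Q}}$, $\mathcal{N}_{\mathrm{house}}(S)=\inf\{X\in[0,\infty) : \#\{\alpha\in S : \overline{|\alpha|}<X\}=\infty\}$, with $\inf\emptyset=\infty$. For a subfield $K\subset\overline{\mathbb{Q}}$ and $\xi\in\overline{\mathbb{Q}}$, $M_{\xi,K}\in K[x]$ is the monic minimal polynomial of $\xi$ over $K$. On $\mathbb{C}^d$ let $\|\boldsymbol{\alpha}\|=\max_{1\le i\le d}|\alpha_i|$. Let $\zeta_d=\exp(2\pi i/d)$ and $\mathbb{T}=\{c\in\mathbb{C}:|c|=1\}$. The finite discrepancy of $\boldsymbol{\xi}=(\xi_1,\ldots,\xi_d)\in\mathbb{C}^d$ is $$D(\boldsymbol{\xi})=\inf_{u\in\mathbb{T}}\max_{1\le j\le d}\min_{1\le i\le d}|\xi_i-u\zeta_d^j|,$$ which is invariant under permuting the entries. Definition of $\eta(K,\xi)$: let $K\subset\overline{\mathbb{Q}}$ be a field, $\xi\in\overline{\mathbb{Q}}\setminus\{0\}$, $d=[K(\xi):K]$. Let $\mathrm{Hom}(K)$ be the set of field homomorphisms $K\to\mathbb{C}$. For $\sigma\in\mathrm{Hom}(K)$ let $\tau_{1,\sigma},\ldots,\tau_{d,\sigma}$ be the $d$ extensions of $\sigma$ to field homomorphisms $K(\xi)\to\mathbb{C}$,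 and $\boldsymbol{\tau}_\sigma(\xi)=(\tau_{1,\sigma}(\xi),\ldots,\tau_{d,\sigma}(\xi))$ (the tuple of the $d$ distinct roots of $\sigma(M_{\xi,K})$). Then $$\eta(K,\xi)=\min_{\sigma\in\mathrm{Hom}(K)}\min\{\|\boldsymbol{\tau}_\sigma(\xi)\|,\|\boldsymbol{\tau}_\sigma(\xi)\|^{d-1}\}\left(1-d^{3/2}D\left(\frac{\boldsymbol{\tau}_\sigma(\xi)}{\|\boldsymbol{\tau}_\sigma(\xi)\|}\right)\right).$$ *)

(* Defs.v *)
(* The field of complex numbers is R[i] for an arbitrary R : realType, and    *)
(* the algebraic closure of Q is its subfield of algebraic numbers.  Subrings *)
(* and subfields of C are sets, so that infinite extensions of Q are allowed. *)
From HB Require Import structures.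
From mathcomp Require Import all_boot all_order all_algebra.
From mathcomp Require Import all_classical all_reals all_analysis.
From mathcomp Require Import complex.

Set Implicit Arguments.
Unset Strict Implicit.
Unset Printing Implicit Defensive.

Import Order.TTheory GRing.Theory Num.Theory.
Import ComplexField.

Local Open Scope classical_set_scope.
Local Open Scope ring_scope.
Local Open Scope complex_scope.

Section Algebra.
Variable R : realType.
Local Notation C := R[i].
Implicit Types (A K L : set C) (a x : C) (p : {poly C}).

Definition is_subring A : Prop := subring_closed [in A].

Definition is_subfield K : Prop := divring_closed [in K].

Definition alg_integer x : Prop := integralOver (intr : int -> C) x.

Definition ring_adjoin A (S : set C) : set C := smallest is_subring (A `|` S).

Definition field_adjoin K x : set C := smallest is_subfield (K `|` [set x]).

Definition fracs A : set C :=
  [set x | exists a b, [/\ A a, A b, b != 0 & x = a / b]].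

Definition is_basis K L (n : nat) (b : 'I_n -> C) : Prop :=
  [/\ forall i, L (b i),
      forall c : 'I_n -> C, (forall i, K (c i)) ->
        \sum_(i < n) c i * b i = 0 -> forall i, c i = 0
    & forall x, L x ->
        exists2 c : 'I_n -> C, (forall i, K (c i)) & x = \sum_(i < n) c i * b i].

(* The degree [L : K], with value 0 when it is infinite. *)
Definition ext_degree K L : nat :=
  xget 0%N [set n | exists b : 'I_n -> C, is_basis K L b].

Definition is_minpoly K x p : Prop :=
  [/\ p \is monic, p \is a polyOver [in K], root p x
    & forall q, q \is a polyOver [in K] -> q != 0 -> root q x ->
        (size p <= size q)%N].

(* The value is 0 when x is not algebraic over K. *)
Definition minpoly K x : {poly C} := xget 0 [set p | is_minpoly K x p].

Definition rationals : set C := range (ratr : rat -> C).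

(* For algebraic x the set of conjugates is finite and nonempty, so the       *)
(* supremum is a maximum.                                                     *)
Definition house x : R :=
  sup [set Normc.normc y | y in [set y | root (minpoly rationals x) y]].

Definition Nhouse (S : set C) : \bar R :=
  ereal_inf [set X%:E | X in
    [set X : R | 0 <= X /\ infinite_set [set a | S a /\ house a < X]]].

(* Homomorphisms K -> C are given by total functions, of which only the       *)
(* restriction to K matters.                                                  *)
Definition is_hom K (s : C -> C) : Prop :=
  [/\ s 1 = 1,
      forall x y, K x -> K y -> s (x + y) = s x + s y
    & forall x y, K x -> K y -> s (x * y) = s x * s y].

Definition extends K L (s t : C -> C) : Prop :=
  is_hom L t /\ (forall x, K x -> t x = s x).

Definition enum_extensions K L (s : C -> C) (d : nat)
    (t : 'I_d -> C -> C) : Prop :=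
  [/\ forall i, extends K L s (t i),
      forall i j, (forall x, L x -> t i x = t j x) -> i = j
    & forall u, extends K L s u ->
        exists i, forall x, L x -> u x = t i x].

End Algebra.

Section Discrepancy.
Variable R : realType.
Local Notation C := R[i].

Definition supnorm (d : nat) (z : 'I_d -> C) : R :=
  \big[Num.max/0]_(i < d) Normc.normc (z i).

Definition zeta (d : nat) : C :=
  cos (2 * pi / d%:R) +i* sin (2 * pi / d%:R).

(* For d > 0 the inner infimum is over a finite nonempty set, hence is a      *)
(* minimum.                                                                   *)
Definition discrepancy (d : nat) (z : 'I_d -> C) : R :=
  inf [set \big[Num.max/0]_(1 <= j < d.+1)
             inf (range (fun i : 'I_d => Normc.normc (z i - u * zeta d ^+ j)))
      | u in [set u : C | Normc.normc u = 1]].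

Definition eta_term (d : nat) (z : 'I_d -> C) : R :=
  Num.min (supnorm z) (supnorm z ^+ d.-1) *
  (1 - d%:R `^ (3 / 2) * discrepancy (fun i => z i / (supnorm z)%:C)).

(* The tuple of the values at x of the extensions of s is only determined up  *)
(* to a permutation, which does not change eta_term; hence t ranges over all  *)
(* enumerations of the extensions.  As x is algebraic over Q whenever this is *)
(* used, there are finitely many values and the infimum is a minimum.         *)
Definition eta_house (K : set C) (x : C) : \bar R :=
  ereal_inf [set v | exists s (t : 'I_(ext_degree K (field_adjoin K x)) -> C -> C),
    [/\ is_hom K s,
        enum_extensions K (field_adjoin K x) s t
      & v = (eta_term (fun i => t i x))%:E]].

End Discrepancy.

Section Tower.
Variable R : realType.
Local Notation C := R[i].

(* The sequence is xi 1, xi 2, ...; the value xi 0 is not used. *)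
Definition tower (O0 : set C) (xi : nat -> C) (i : nat) : set C :=
  ring_adjoin O0 [set xi j | j in [set j | (1 <= j <= i)%N]].

Definition tower_field (O0 : set C) (xi : nat -> C) (i : nat) : set C :=
  fracs (tower O0 xi i).

Definition tower_union (O0 : set C) (xi : nat -> C) : set C :=
  \bigcup_(i in [set i | (1 <= i)%N]) tower O0 xi i.

End Tower.

(* Main.v *)
Require Import Defs.
From HB Require Import structures.
From mathcomp Require Import all_boot all_order all_algebra.
From mathcomp Require Import separable.
From mathcomp Require Import all_classical all_reals all_analysis.
From mathcomp Require Import complex.
From mathcomp Require Import ring lra zify.
Import Order.TTheory GRing.Theory Num.Theory.
Local Open Scope classical_set_scope.
Local Open Scope ring_scope.

Set Implicit Arguments.
Unset Strict Implicit.
Unset Printing Implicit Defensive.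

(** The point is a lower bound for the house of every element that is new at
    some step of the tower.

    Let A be a ring of algebraic integers with fraction field K, let x be an
    algebraic integer of degree d > 1 over K whose minimal polynomial has its
    coefficients in A, and let beta lie in A[x] but not in A.  Division by the
    minimal polynomial gives beta = sum_(k < d) a_k x^k with a_k in A, and
    a_m != 0 for some m > 0.  A nonzero algebraic integer has a norm of absolute
    value at least 1, hence |s(a_m)| >= 1 for some embedding s of K
    ([hom_conjugate_ge1]).  Let z_1, ..., z_d be the values at x of the
    extensions of s to K(x), S their sup norm, y_i = z_i / S, and
    b_k = s(a_k) S^k.  The same extensions send beta to
    v_i = sum_k b_k y_i^k.

    If the y_i were the points u zeta_d^j for some u on the unit circle, the
    discrete Fourier transform would be an isometry up to scale: the mean of
    the |v_i|^2 would be the sum of the |b_k|^2 ([parseval]), so that some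
    |v_i| would be at least the Euclidean norm N of b.  In general, if u
    is almost optimal in the definition of the discrepancy D, each u zeta_d^j is
    almost within D of some y_i, and replacing one by the other changes the value
    by little more than N d^(3/2) D at worst; hence
    max_i |v_i| >= N (1 - d^(3/2) D) ([coef_norm_discrepancy]).  As
    N >= |b_m| >= S^m >= min(S, S^(d-1)), and as each |v_i| is at most the house
    of beta, this gives eta(K, x) <= house(beta)
    ([eta_house_le_house_adjoin]).

    Now suppose that infinitely many elements of the union of the tower have
    house below X, and that X is less than the lower limit.  Then X < eta at all
    steps from some N on, so by the bound those elements all lie in the N-th
    ring, which has only finitely many elements of house below X: a
    contradiction.

    On the algebraic side, a subfield of C that is given as a set is presented
    as the range of a morphism iota : F -> C from a field F
    ([subfield_range]), so that the theory of polynomials over a field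
    applies to {poly F}.  Because K may have infinite degree over the rationals,
    the embedding s is obtained by Zorn's lemma ([hom_graph_extend]).  Its
    extensions to K(x) correspond to the roots of the image of the minimal
    polynomial, and there are exactly d of them by separability
    ([enumerate_extensions]). *)

(** * Moduli of complex numbers and roots of unity *)

Section Modulus.
Variable R : realType.
Local Notation C := R[i]%C.
Import Normc.

Lemma normc_ge0 (x : C) : 0 <= normc x.
Proof. by case: x => a b; exact: sqrtr_ge0. Qed.

Lemma normc0E : normc (0 : C) = 0. Proof. exact: normc0. Qed.

Lemma normcX (x : C) n : normc (x ^+ n) = normc x ^+ n.
Proof.
elim: n => [|n IH]; first by rewrite !expr0; exact: normc1.
by rewrite !exprS normcM IH.
Qed.

Lemma normc_sum (I : Type) (r : seq I) (P : pred I) (F : I -> C) :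
  normc (\sum_(i <- r | P i) F i) <= \sum_(i <- r | P i) normc (F i).
Proof.
apply: (big_ind2 (fun x y => normc x <= y)) => //; first by rewrite normc0E.
by move=> x1 y1 x2 y2 h1 h2; apply: le_trans (le_normcD _ _) (lerD h1 h2).
Qed.

Lemma normc_real (r : R) : 0 <= r -> normc (r%:C)%C = r.
Proof. by move=> r0 /=; rewrite expr0n /= addr0 sqrtr_sqr ger0_norm. Qed.

Lemma normc_sqr (x : C) : ((normc x ^+ 2)%:C)%C = x * (x^*)%C.
Proof. by rewrite rmorphXn -sqr_normc. Qed.

Lemma real_complex_sum (I : Type) (r : seq I) (P : pred I) (F : I -> R) :
  ((\sum_(i <- r | P i) F i)%:C)%C = \sum_(i <- r | P i) ((F i)%:C)%C.
Proof. exact: rmorph_sum. Qed.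

Lemma normc_gt0 (x : C) : x != 0 -> 0 < normc x.
Proof.
move=> x0; rewrite lt_neqAle normc_ge0 andbT eq_sym.
by apply: contra x0 => /eqP/eq0_normc ->.
Qed.

(** Raising points of the closed unit disc to the n-th power is n-Lipschitz: in
    the factorisation of x^n - y^n the cofactor is a sum of n terms of modulus
    at most 1. *)
Lemma normcB_expr (x y : C) n :
  normc x <= 1 -> normc y <= 1 -> normc (x ^+ n - y ^+ n) <= n%:R * normc (x - y).
Proof.
move=> hx hy; rewrite subrXX normcM mulrC.
apply: ler_wpM2r; first exact: normc_ge0.
apply: le_trans (normc_sum _ _ _) _.
have -> : n%:R = \sum_(i < n) (1 : R) by rewrite sumr_const card_ord.
apply: ler_sum => i _; rewrite normcM !normcX.
by rewrite mulr_ile1 ?exprn_ge0 ?normc_ge0 // exprn_ile1 ?normc_ge0.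
Qed.

End Modulus.

Section RootsOfUnity.
Variable R : realType.
Local Notation C := R[i]%C.
Import Normc.

Lemma zetaX d n : zeta R d ^+ n =
  (cos (n%:R * (2 * pi / d%:R)) +i* sin (n%:R * (2 * pi / d%:R)))%C.
Proof.
elim: n => [|n IH]; first by rewrite expr0 mul0r cos0 sin0.
set t := 2 * pi / d%:R in IH *.
have -> : n.+1%:R * t = t + n%:R * t by rewrite -natr1; ring.
rewrite exprS IH cosD sinD /zeta -/t; simpc.
by congr (_ +i* _)%C; rewrite addrC.
Qed.

(** Since cos x = 1 - 2 sin^2 (x / 2), and the sine is positive on ]0, pi[. *)
Lemma cos_eq1 (x : R) : 0 <= x < 2 * pi -> cos x = 1 -> x = 0.
Proof.
move=> /andP[x0 xpi] cx.
have [//|xn0] := eqVneq x 0.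
have xgt : 0 < x by rewrite lt_neqAle eq_sym xn0.
have hs : 0 < sin (x / 2) by apply: sin_gt0_pi; lra.
have : cos ((x / 2) *+ 2) = 1 by rewrite -mulr_natr mulfVK.
rewrite cos_mulr2n cos2sin2; nra.
Qed.

Lemma zeta_prim d : (0 < d)%N -> d.-primitive_root (zeta R d).
Proof.
move=> d0; rewrite /primitive_root_of_unity d0 /=.
have dR : 0 < d%:R :> R by rewrite ltr0n.
apply/forallP => i; apply/eqP; rewrite unity_rootE zetaX.
case: (eqVneq i.+1 d) => [->|nid].
  apply/eqP; rewrite mulrCA divff ?gt_eqF // mulr1.
  have -> : 2 * pi = pi *+ 2 :> R by rewrite mulr_natl.
  by rewrite cos2pi sin_mulr2n sinpi mulr0 mul0rn.
apply/negP => /eqP [hc _].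
have lt_id : (i.+1 < d)%N by rewrite ltn_neqAle nid ltn_ord.
have p0 : 0 < pi :> R := pi_gt0 R.
have : i.+1%:R * (2 * pi / d%:R) = 0 :> R.
  apply: cos_eq1 hc; apply/andP; split.
    by rewrite mulr_ge0 ?ler0n // divr_ge0 ?ler0n // mulr_ge0 // ltW.
  rewrite mulrCA gtr_pMr; last by rewrite mulr_gt0.
  by rewrite ltr_pdivrMr // mul1r ltr_nat.
by apply/eqP; rewrite !mulf_neq0 ?invr_eq0 ?pnatr_eq0 ?gt_eqF.
Qed.

Lemma normc_zeta d : normc (zeta R d) = 1.
Proof. by rewrite /= cos2Dsin2 sqrtr1. Qed.

Lemma conj_unit (w : C) : normc w = 1 -> w * (w^*)%C = 1.
Proof. by move=> hw; rewrite -normc_sqr hw expr1n. Qed.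

(** For k != l the sum is geometric with ratio zeta^(k - l), a d-th root of
    unity different from 1 because zeta is primitive and k, l < d. *)
Lemma rotated_roots_orthogonal d (u : C) (k l : 'I_d) : normc u = 1 ->
  \sum_(j < d) (u * zeta R d ^+ j.+1) ^+ k * (((u * zeta R d ^+ j.+1) ^+ l)^*)%C
    = d%:R * (k == l)%:R.
Proof.
move=> hu; set z := zeta R d.
have d0 : (0 < d)%N by case: d k {l z} => [[]|].
have zp : d.-primitive_root z by exact: zeta_prim.
have nw j : normc (u * z ^+ j) = 1.
  by rewrite normcM normcX hu normc_zeta expr1n mulr1.
have [<-|nkl] := eqVneq k l.
  rewrite mulr1 -[d in d%:R]card_ord -sumr_const; apply: eq_bigr => j _.
  by rewrite rmorphXn -exprMn conj_unit ?expr1n.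
rewrite mulr0; pose q : C := z ^+ k * (z^*)%C ^+ l.
have zc : z * (z^*)%C = 1 by rewrite conj_unit ?normc_zeta.
have q1 : q != 1.
  apply: contra nkl => /eqP q1; rewrite -val_eqE /=.
  have : z ^+ k = z ^+ l.
    by rewrite -[RHS]mul1r -q1 /q -mulrA -exprMn [_ * z]mulrC zc expr1n mulr1.
  by move/eqP; rewrite (eq_prim_root_expr zp) !modn_small ?ltn_ord.
have qd : q ^+ d = 1.
  have zcd : (z^*)%C ^+ d = 1.
    by have := rmorphXn (@conjc R) d z; rewrite (prim_expr_order zp) rmorph1.
  by rewrite exprMn exprAC (prim_expr_order zp) exprAC zcd !expr1n mulr1.
have -> : \sum_(j < d) (u * z ^+ j.+1) ^+ k * (((u * z ^+ j.+1) ^+ l)^*)%C =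
    (u ^+ k * (u^*)%C ^+ l * q) * \sum_(j < d) q ^+ j.
  rewrite mulr_sumr; apply: eq_bigr => j _.
  rewrite rmorphXn rmorphM !exprMn rmorphXn.
  rewrite (exprAC _ _ k) (exprAC _ _ l) mulrACA.
  rewrite -[RHS]mulrA; congr (_ * _).
  by rewrite !exprS mulrACA.
have : (1 - q) * \sum_(j < d) q ^+ j = 0.
  have := subrXX 1 q d; rewrite expr1n qd subrr => h.
  rewrite [RHS]h; congr (_ * _); apply: eq_bigr => i _; by rewrite expr1n mul1r.
move/eqP; rewrite mulf_eq0 subr_eq0 eq_sym (negbTE q1) /= => /eqP ->.
by rewrite mulr0.
Qed.

(** Expanding the squared moduli and exchanging sums reduces the identity to the
    orthogonality of the monomials on the rotated roots of unity.  The index is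
    shifted to j.+1 because the discrepancy runs over the exponents 1, ..., d. *)
Lemma parseval d (u : C) (b : 'I_d -> C) : normc u = 1 ->
  \sum_(j < d) normc (\sum_(k < d) b k * (u * zeta R d ^+ j.+1) ^+ k) ^+ 2
    = d%:R * \sum_(k < d) normc (b k) ^+ 2.
Proof.
move=> hu; apply: complexI.
transitivity (d%:R * \sum_(k < d) ((normc (b k) ^+ 2)%:C)%C); last first.
  by rewrite -real_complex_sum rmorphM rmorph_nat.
rewrite real_complex_sum.
pose w (j : 'I_d) := u * zeta R d ^+ j.+1.
transitivity (\sum_(j < d) \sum_(k < d) \sum_(l < d)
   (b k * (b l)^*%C) * (w j ^+ k * (w j ^+ l)^*%C)).
  apply: eq_bigr => j _; rewrite normc_sqr rmorph_sum mulr_suml.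
  apply: eq_bigr => k _; rewrite mulr_sumr; apply: eq_bigr => l _.
  by rewrite rmorphM mulrACA.
rewrite exchange_big mulr_sumr; apply: eq_bigr => k _.
rewrite exchange_big (bigD1 k) //= -mulr_sumr rotated_roots_orthogonal // eqxx mulr1.
rewrite -normc_sqr mulrC big1 ?addr0 // => l nlk.
by rewrite -mulr_sumr rotated_roots_orthogonal // eq_sym (negbTE nlk) !mulr0.
Qed.

End RootsOfUnity.

(** * The discrete Fourier transform and the discrepancy *)

Section EtaBound.
Variable R : realType.
Local Notation C := R[i]%C.
Import Normc.

(** The difference of the two sides is half the sum of all (x_i - x_j)^2. *)
Lemma sqr_sum_le d (x : 'I_d -> R) :
  (\sum_i x i) ^+ 2 <= d%:R * \sum_i x i ^+ 2.
Proof.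
have : 0 <= \sum_i \sum_j (x i - x j) ^+ 2.
  by apply: sumr_ge0 => i _; apply: sumr_ge0 => j _; exact: sqr_ge0.
have -> : \sum_i \sum_j (x i - x j) ^+ 2 =
    (d%:R * \sum_i x i ^+ 2 - (\sum_i x i) ^+ 2) *+ 2.
  have -> : \sum_i \sum_j (x i - x j) ^+ 2 =
      \sum_i (d%:R * x i ^+ 2 + \sum_j x j ^+ 2 - x i * (\sum_j x j) *+ 2).
    apply: eq_bigr => i _; under eq_bigr do rewrite sqrrB.
    rewrite big_split /= sumrB sumr_const card_ord sumrMnl -mulr_sumr mulr_natl.
    by rewrite addrAC.
  rewrite sumrB big_split /= sumr_const card_ord -mulr_sumr sumrMnl -mulr_suml.
  by rewrite -[_ *+ d]mulr_natl; ring.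
by rewrite pmulrn_lge0 // subr_ge0.
Qed.

Lemma supnorm_ge d (z : 'I_d -> C) i : normc (z i) <= supnorm z.
Proof. by rewrite /supnorm; apply: le_bigmax. Qed.

Lemma inf_range_attained d (f : 'I_d -> R) : (0 < d)%N ->
  exists i, f i <= inf (range f).
Proof.
case: d f => // d f _; pose i0 := [arg min_(i < ord0) f i]%O.
exists i0; apply: lb_le_inf; first by exists (f ord0), ord0.
by move=> _ [i _ <-]; rewrite /i0; case: arg_minP => // j _; apply.
Qed.

(** One rotation u at a time: y are points of the closed unit disc, each
    rotated root of unity is within delta of one of them, and B bounds the values
    at the points y of the polynomial with coefficients b. *)
Section RotatedGrid.
Variables (d : nat) (y b : 'I_d -> C) (B : R) (u : C) (delta : R).
Hypotheses (d_gt0 : (0 < d)%N) (y_le1 : forall i, normc (y i) <= 1).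
Hypotheses (normu : normc u = 1).
Hypothesis (values_le : forall i, normc (\sum_(k < d) b k * y i ^+ k) <= B).
Hypothesis close : forall j : 'I_d,
  exists i, normc (y i - u * zeta R d ^+ j.+1) <= delta.

Let N : R := Num.sqrt (\sum_(k < d) normc (b k) ^+ 2).

(** At a rotated root of unity w with |y_i - w| <= delta, the value of the
    polynomial differs from its value at y_i by at most
    sum_k |b_k| k delta <= d delta sum_k |b_k| <= d^(3/2) delta N, by
    Cauchy-Schwarz.  So all the values at the rotated roots of unity are at
    most B + N d^(3/2) delta, and by Parseval their quadratic mean is N. *)
Lemma coef_norm_le_values : N <= B + N * (d%:R `^ (3 / 2) * delta).
Proof.
have dR : 0 < d%:R :> R by rewrite ltr0n.
have S0 : 0 <= \sum_(k < d) normc (b k) ^+ 2.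
  by apply: sumr_ge0 => k _; exact: sqr_ge0.
have N0 : 0 <= N by exact: sqrtr_ge0.
have N2 : N ^+ 2 = \sum_(k < d) normc (b k) ^+ 2 by rewrite sqr_sqrtr.
have B0 : 0 <= B by apply: le_trans (values_le (Ordinal d_gt0)); exact: normc_ge0.
have delta0 : 0 <= delta.
  by have [i /(le_trans _)->] := close (Ordinal d_gt0); rewrite ?normc_ge0.
have p32 : d%:R `^ (3 / 2) = d%:R * Num.sqrt d%:R :> R.
  have -> : 3 / 2 = 1 + 2^-1 :> R by lra.
  rewrite powRD; last by rewrite (gt_eqF dR) implybT.
  by rewrite powRr1 ?powR12_sqrt ?ler0n.
have sumb : \sum_(k < d) normc (b k) <= Num.sqrt d%:R * N.
  rewrite -(@ler_pXn2r _ 2) ?nnegrE ?mulr_ge0 ?sqrtr_ge0 //; last first.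
    by apply: sumr_ge0 => k _; exact: normc_ge0.
  by rewrite exprMn sqr_sqrtr ?ler0n // N2 sqr_sum_le.
set E := N * _.
have E0 : 0 <= E by rewrite !mulr_ge0 ?powR_ge0.
have wle (j : 'I_d) :
    normc (\sum_(k < d) b k * (u * zeta R d ^+ j.+1) ^+ k) <= B + E.
  set w := u * _; have nw : normc w = 1.
    by rewrite normcM normcX normu normc_zeta expr1n mulr1.
  have [i hi] := close j.
  have -> : \sum_(k < d) b k * w ^+ k =
      \sum_(k < d) b k * y i ^+ k - \sum_(k < d) b k * (y i ^+ k - w ^+ k).
    by rewrite -sumrB; apply: eq_bigr => k _; rewrite mulrBr subKr.
  apply: le_trans (le_normcD _ _) _; rewrite normcN lerD //.
  apply: le_trans (normc_sum _ _ _) _.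
  apply: (@le_trans _ _ (\sum_(k < d) normc (b k) * (d%:R * delta))).
    apply: ler_sum => k _; rewrite normcM ler_wpM2l ?normc_ge0 //.
    apply: le_trans (normcB_expr _ (y_le1 i) _) _; first by rewrite nw.
    by rewrite ler_pM ?ler0n ?normc_ge0 // ler_nat ltnW.
  rewrite -mulr_suml /E p32 !mulrA ler_wpM2r // -[leRHS]mulrA [d%:R * _]mulrC mulrA.
  by rewrite ler_wpM2r ?ler0n // mulrC.
rewrite -(@ler_pXn2r _ 2) ?nnegrE ?addr_ge0 // N2.
rewrite -(ler_pM2l dR) -(parseval b normu).
apply: (@le_trans _ _ (\sum_(j < d) (B + E) ^+ 2)); last first.
  by rewrite sumr_const card_ord mulr_natl.
apply: ler_sum => j _.
by rewrite ler_pXn2r ?nnegrE ?normc_ge0 ?addr_ge0.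
Qed.

End RotatedGrid.

(** For a single rotation the previous bound reads (N - B) / (N d^(3/2)) <= delta,
    with a left-hand side that is independent of the rotation, so it passes to the
    infimum that defines the discrepancy. *)
Lemma coef_norm_discrepancy d (y b : 'I_d -> C) (B : R) : (0 < d)%N ->
  (forall i, normc (y i) <= 1) ->
  (forall i, normc (\sum_(k < d) b k * y i ^+ k) <= B) ->
  Num.sqrt (\sum_(k < d) normc (b k) ^+ 2)
    * (1 - d%:R `^ (3 / 2) * discrepancy y) <= B.
Proof.
move=> d0 y1 hB; set N := Num.sqrt _.
have dR : 0 < d%:R :> R by rewrite ltr0n.
have B0 : 0 <= B by apply: le_trans (hB (Ordinal d0)); exact: normc_ge0.
have [->|N0] := eqVneq N 0; first by rewrite mul0r.
have Np : 0 < N by rewrite lt_neqAle eq_sym N0 sqrtr_ge0.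
have d32 : 0 < d%:R `^ (3 / 2) :> R by rewrite powR_gt0.
suff : (N - B) / (N * d%:R `^ (3 / 2)) <= discrepancy y.
  rewrite ler_pdivrMr ?mulr_gt0 // mulrBr mulr1 mulrC -mulrA; lra.
apply: lb_le_inf.
  by exists (\big[Num.max/0]_(1 <= j < d.+1)
     inf (range (fun i : 'I_d => normc (y i - 1 * zeta R d ^+ j)))), 1 => //; exact: normc1.
move=> _ [u /= hu <-]; set delta := \big[_/_]_(_ <= _ < _) _.
rewrite ler_pdivrMr ?mulr_gt0 // lerBlDl mulrC -mulrA.
apply: (coef_norm_le_values d0 y1 hu hB) => j.
have [i hi] := inf_range_attained (fun i => normc (y i - u * zeta R d ^+ j.+1)) d0.
exists i; apply: le_trans hi _.
rewrite /delta big_add1 /= big_mkord.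
exact: (le_bigmax (0 : R) (fun j : 'I_d =>
  inf (range (fun i => normc (y i - u * zeta R d ^+ j.+1)))) j).
Qed.

(** After rescaling the z_i into the unit disc, the coefficient of index m has
    modulus at least S^m, S being the sup norm; for 0 < m < d this is at least
    min(S, S^(d-1)).  When 1 - d^(3/2) D is negative, so is the eta term. *)
Lemma eta_term_le_value d (z a : 'I_d -> C) (m : 'I_d) : 0 < supnorm z ->
  (0 < m)%N -> 1 <= normc (a m) ->
  exists i, eta_term z <= normc (\sum_(k < d) a k * z i ^+ k).
Proof.
move=> S0 m0 am; set S := supnorm z in S0.
have d0 : (0 < d)%N by case: d m {z a m0 am S S0} => [[]|].
pose v i := normc (\sum_(k < d) a k * z i ^+ k).
have [i hv] : exists i, forall j, v j <= v i.
  exists [arg max_(i > Ordinal d0) v i]%O => j.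
  by case: arg_maxP => // i _; apply.
exists i; rewrite -/(v i); pose y i := z i / (S%:C)%C.
have nS : normc (S%:C)%C = S by rewrite normc_real ?ltW.
have Sn0 : (S%:C)%C != 0.
  by apply/eqP => h; rewrite h normc0E in nS; rewrite -nS ltxx in S0.
have y1 j : normc (y j) <= 1.
  by rewrite normcM normcV nS ler_pdivrMr // mul1r supnorm_ge.
pose b k := a k * (S%:C)%C ^+ (k : 'I_d).
have hB j : normc (\sum_(k < d) b k * y j ^+ k) <= v i.
  rewrite (_ : \sum_(k < d) _ = \sum_(k < d) a k * z j ^+ k) ?hv //.
  by apply: eq_bigr => k _; rewrite /b -mulrA -exprMn [_ * y j]mulrC divfK.
have key := coef_norm_discrepancy d0 y1 hB.
set N := Num.sqrt _ in key.
rewrite /eta_term -/S -/y; set t := 1 - _ in key *.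
have mle : Num.min S (S ^+ d.-1) <= S ^+ m.
  rewrite ge_min; case: (leP S 1) => hS; apply/orP.
    by right; apply: ler_wiXn2l; rewrite ?(ltW S0) // -ltnS prednK.
  by left; rewrite -{1}[S]expr1; apply: ler_weXn2l => //; exact: ltW.
have SN : S ^+ m <= N.
  apply: (@le_trans _ _ (normc (b m))).
    by rewrite normcM normcX nS ler_peMl // exprn_ge0 // ltW.
  have <- : Num.sqrt (normc (b m) ^+ 2) = normc (b m).
    by rewrite sqrtr_sqr ger0_norm ?normc_ge0.
  rewrite ler_wsqrtr // (bigD1 m) //= lerDl.
  by apply: sumr_ge0 => k _; exact: sqr_ge0.
have [t0|t0] := leP 0 t.
  by apply: le_trans key; rewrite ler_wpM2r // (le_trans mle).
apply: (@le_trans _ _ 0); last exact: normc_ge0.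
by rewrite mulr_ge0_le0 ?(ltW t0) // le_min (ltW S0) exprn_ge0 ?(ltW S0).
Qed.

End EtaBound.

(** * Minimal polynomials, subfields of C and degrees *)

Section Minimal.
Variables (F L : fieldType) (iota : {rmorphism F -> L}).

(** The minimal polynomial of x, characterised by the ideal that it generates:
    this form is used directly for well-definedness of evaluation maps. *)
Definition minimal_over (x : L) (p : {poly F}) : Prop :=
  [/\ p \is monic, root (map_poly iota p) x
    & forall q, root (map_poly iota q) x -> p %| q].

Lemma minimal_exists x : algebraicOver iota x -> exists p, minimal_over x p.
Proof.
move=> [p0 p0n0 p0x].
pose P n := `[< exists p : {poly F}, [/\ p != 0, root (map_poly iota p) x & size p = n] >].
have exP : exists n, P n by exists (size p0); apply/asboolP; exists p0.
case: (ex_minnP exP) => n /asboolP [p [pn0 px <-]] minp.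
have lc0 : (lead_coef p)^-1 != 0 by rewrite invr_eq0 lead_coef_eq0.
exists ((lead_coef p)^-1 *: p); split.
- by rewrite monicE lead_coefZ mulVf ?lead_coef_eq0.
- by rewrite map_polyZ rootZ ?fmorph_eq0.
move=> q qx; rewrite dvdpZl //; apply/modp_eq0P; apply/eqP; apply: contraT => rn0.
have rx : root (map_poly iota (q %% p)) x.
  move: qx; rewrite {1}(divp_eq q p) rmorphD rmorphM !rootE hornerD hornerM.
  by rewrite (rootP px) mulr0 add0r.
have : P (size (q %% p)) by apply/asboolP; exists (q %% p).
by move/minp; rewrite leqNgt ltn_modp pn0.
Qed.

(** A minimal polynomial p is irreducible: if p = h g with g = gcd(p, q), then x is
    a root of h or of g; the second is excluded since q does not vanish at x, and
    the first makes p divide h, so that g is constant. *)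
Lemma minimal_coprime x p q : minimal_over x p ->
  ~~ root (map_poly iota q) x -> coprimep p q.
Proof.
move=> [pm px pmin] qx.
have pn0 := monic_neq0 pm.
have [h hE] := dvdpP _ _ (dvdp_gcdl p q).
have hn0 : h != 0 by apply: contraNneq pn0 => h0; rewrite hE h0 mul0r.
have gn0 : gcdp p q != 0 by rewrite gcdp_eq0 negb_and pn0.
have : root (map_poly iota h) x || root (map_poly iota (gcdp p q)) x.
  by rewrite -rootM -rmorphM -hE.
case/orP => [hx|gx].
  have le_ph : (size p <= size h)%N by apply: dvdp_leq (pmin _ hx).
  have sp : size p = (size h + size (gcdp p q)).-1 by rewrite {1}hE size_mul.
  have aux (a b : nat) : (0 < a -> 0 < b -> (b + a).-1 <= b -> a == 1)%N by lia.
  by apply: (aux _ (size h)); rewrite ?size_poly_gt0 // -sp.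
case/negP: qx; have [k ->] := dvdpP _ _ (dvdp_gcdr p q).
by rewrite rmorphM rootM gx orbT.
Qed.

(** In characteristic zero the derivative of p is nonzero of smaller degree, so
    it does not vanish at x and is coprime to p. *)
Lemma minimal_separable x p : (forall n, n.+1%:R != 0 :> F) ->
  minimal_over x p -> separable_poly p.
Proof.
move=> char0 pmin; rewrite unlock; apply: (minimal_coprime pmin).
have [pm px minp] := pmin.
have pn0 := monic_neq0 pm.
have p1 : (1 < size p)%N.
  by rewrite -(size_map_poly iota); apply: root_size_gt1 px; rewrite map_poly_eq0.
apply/negP => /minp.
have dn0 : p^`() != 0.
  apply: contraNneq (char0 (size p).-2) => d0.
  have /polyP/(_ (size p).-2) := d0; rewrite coef_deriv coef0.
  case: (size p) (p1) (lead_coefE p) => [|[|n]] //= _ <-.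
  by rewrite (monicP pm) => ->.
by move/(dvdp_leq dn0); rewrite leqNgt lt_size_deriv.
Qed.

End Minimal.

(** The predicate polyOver only looks at the coefficients below the size, whence
    the condition that K contains 0. *)
Lemma polyOver_setP (R : nzRingType) (K : set R) (p : {poly R}) : K 0 ->
  p \is a polyOver [in K] <-> forall i, K p`_i.
Proof.
move=> K0; split=> [/allP pK i|pK].
  have [lt_ip|le_pi] := ltnP i (size p); last by rewrite nth_default.
  by apply: set_mem; apply: pK; exact: mem_nth.
by apply/(all_nthP 0) => i _; apply: mem_set; exact: pK.
Qed.

Lemma polyOver_range (S R : nzRingType) (iota : {rmorphism S -> R}) (K : set R)
    (p : {poly R}) : K = range iota ->
  p \is a polyOver [in K] -> exists q, p = map_poly iota q.
Proof.
move=> KE; have K0 : K 0 by rewrite KE; exists 0; rewrite ?rmorph0.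
move=> /(polyOver_setP _ K0) pK.
have /choice [f fE] : forall i, exists a, p`_i = iota a.
  by move=> i; have := pK i; rewrite KE => -[a _ <-]; exists a.
exists (\poly_(i < size p) f i); apply/polyP => i.
rewrite coef_map coef_poly; case: ltnP => // hi.
by rewrite raddf0 nth_default.
Qed.

Section MinpolyDefs.
Variables (R : realType) (F : fieldType).
Local Notation C := R[i]%C.
Variable (iota : {rmorphism F -> C}).

Lemma map_polyOver_range (K : set C) q : K = range iota ->
  map_poly iota q \is a polyOver [in K].
Proof.
move=> KE; apply/polyOver_setP; first by rewrite KE; exists 0; rewrite ?rmorph0.
by move=> i; rewrite coef_map KE; exists q`_i.
Qed.

(** A monic polynomial of least size that vanishes at x is unique, so the choice
    in the definition of minpoly is harmless. *)
Lemma minpoly_range (K : set C) x q : K = range iota -> minimal_over iota x q ->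
  minpoly K x = map_poly iota q.
Proof.
move=> KE [qm qx qmin].
have qis : is_minpoly K x (map_poly iota q).
  split=> //; first by rewrite map_monic.
    exact: map_polyOver_range.
  move=> p /(polyOver_range KE) [p' ->]; rewrite map_poly_eq0 => pn0 /qmin pdiv.
  by rewrite !size_map_poly dvdp_leq.
have [pm /(polyOver_range KE) [p' pE] px pmin] : is_minpoly K x (minpoly K x).
  by rewrite /minpoly; apply: (xgetPex 0); exists (map_poly iota q).
have p'x : root (map_poly iota p') x by rewrite -pE.
have p'm : p' \is monic by rewrite -(map_monic iota) -pE.
rewrite pE; congr map_poly; apply/eqP; rewrite eq_sym -eqp_monic //.
rewrite -dvdp_size_eqp ?qmin // eqn_leq dvdp_leq ?qmin ?(monic_neq0 p'm) //=.
have := pmin (map_poly iota q); rewrite pE !size_map_poly; apply => //.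
  exact: map_polyOver_range.
by rewrite map_poly_eq0 monic_neq0.
Qed.

End MinpolyDefs.

Section SubfieldType.
Variables (R : realType) (K : set R[i]%C) (subK : is_subfield K).

Definition subfield_pred (_ : is_subfield K) : {pred R[i]%C} := ([in K]).

HB.instance Definition _ :=
  GRing.isDivringClosed.Build _ (subfield_pred subK) subK.

Record subfield_type :=
  Subfield { subfield_val : R[i]%C; _ : subfield_val \in subfield_pred subK }.

HB.instance Definition _ := [isSub for subfield_val].
HB.instance Definition _ := [Choice of subfield_type by <:].
HB.instance Definition _ := [SubChoice_isSubIntegralDomain of subfield_type by <:].
HB.instance Definition _ := [SubIntegralDomain_isSubField of subfield_type by <:].

End SubfieldType.

(** A subfield given as a set becomes a fieldType together with its embedding,
    which makes polynomial division and matrices over it available. *)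
Lemma subfield_range (R : realType) (K : set R[i]%C) : is_subfield K ->
  exists (F : fieldType) (iota : {rmorphism F -> R[i]%C}), K = range iota.
Proof.
move=> subK; exists (subfield_type subK).
exists (GRing.RMorphism.clone _ _ (\val : subfield_type subK -> _) _).
apply/seteqP; split=> [y /mem_set Ky|_ [a _ <-]]; first by exists (Subfield Ky).
by apply: set_mem; exact: (valP a).
Qed.

Section FieldImage.
Variables (R : realType) (F : fieldType).
Local Notation C := R[i]%C.
Variables (iota : {rmorphism F -> C}) (K : set C).
Hypothesis KE : K = range iota.

Lemma in_range (a : F) : K (iota a).
Proof. by rewrite KE; exists a. Qed.

Lemma range_lift y : K y -> exists a : F, iota a = y.
Proof. by rewrite KE => -[a _]; exists a. Qed.

Lemma range_char0 n : n.+1%:R != 0 :> F.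
Proof. by rewrite -(fmorph_eq0 iota) rmorph_nat pnatr_eq0. Qed.

(** A homomorphism in the sense of total functions restricted to K is the same as
    a ring morphism on the abstract field F. *)
Lemma hom_rmorphism (s : C -> C) : is_hom K s ->
  exists f : {rmorphism F -> C}, forall a, f a = s (iota a).
Proof.
move=> [s1 sD sM]; pose f (a : F) := s (iota a).
have fB : additive f.
  move=> a b; apply/eqP; rewrite eq_sym subr_eq; apply/eqP.
  rewrite /f -sD; try exact: in_range.
  by rewrite -rmorphD subrK.
have fM : multiplicative f.
  split=> [a b|]; last by rewrite /f rmorph1.
  by rewrite /f rmorphM sM //; exact: in_range.
pose fA := GRing.isAdditive.Build F C f fB.
pose fMx := GRing.isMultiplicative.Build F C f fM.
pose f' : {rmorphism F -> C} := HB.pack f fA fMx.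
by exists f'.
Qed.

(** Writing the family c on the generators b gives an n x m matrix over F, and a
    vector in its row kernel is a linear relation between the c_j; so the
    matrix has rank n. *)
Lemma basis_card (L : set C) m n (b : 'I_m -> C) (c : 'I_n -> C) :
  is_basis K L b -> is_basis K L c -> (n <= m)%N.
Proof.
move=> [_ _ spanb] [cL cfree _].
have /choice [A hA] : forall j, exists A : 'I_m -> F, c j = \sum_i iota (A i) * b i.
  move=> j; have [g gK ->] := spanb _ (cL j).
  have /choice [A hA] := fun i => range_lift (gK i).
  by exists A; apply: eq_bigr => i _; rewrite hA.
pose M : 'M[F]_(n, m) := \matrix_(j, i) A j i.
suff : row_free M by rewrite -row_leq_rank => /leq_trans; apply; exact: rank_leq_col.
rewrite -kermx_eq0; apply: contraT => /rowV0Pn [v /sub_kermxP vM vn0].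
case/negP: vn0; apply/eqP/rowP => j; rewrite mxE.
apply: (fmorph_inj iota); rewrite rmorph0.
apply: (cfree (fun j => iota (v 0 j))) => [k|]; first exact: in_range.
under eq_bigr do rewrite hA mulr_sumr.
rewrite exchange_big big1 //= => i _.
under eq_bigr do rewrite mulrA -rmorphM.
rewrite -mulr_suml -rmorph_sum /=.
have /rowP/(_ i) := vM; rewrite !mxE => e.
rewrite [X in iota X](_ : _ = 0) ?rmorph0 ?mul0r // -[RHS]e.
by apply: eq_bigr => k _; rewrite !mxE.
Qed.

Lemma ext_degreeE (L : set C) n (b : 'I_n -> C) :
  is_basis K L b -> ext_degree K L = n.
Proof.
move=> bb; have [c cb] : [set n | exists b : 'I_n -> C, is_basis K L b] (ext_degree K L).
  by apply: xgetPex; exists n, b.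
by apply/eqP; rewrite eqn_leq (basis_card bb cb) (basis_card cb bb).
Qed.

End FieldImage.

(** * Extension of homomorphisms *)

Section HomGraph.
Variable R : realType.
Local Notation C := R[i]%C.
Implicit Types G : set (C * C).

(** Graphs of field homomorphisms from a subfield of C to C.  This form has no
    domain to carry around and is stable under unions of chains, as Zorn's
    lemma requires; the last clause, given closure under subtraction, says that
    the relation is functional. *)
Definition hom_graph G : Prop :=
  [/\ G (1, 1),
      forall x y x' y', G (x, y) -> G (x', y') -> G (x - x', y - y'),
      forall x y x' y', G (x, y) -> G (x', y') -> G (x * x', y * y'),
      forall x y, G (x, y) -> G (x^-1, y^-1)
    & forall y, G (0, y) -> y = 0].

Definition graph_dom G : set C := [set x | exists y, G (x, y)].

Definition graph_fun G (x : C) : C := xget 0 [set y | G (x, y)].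

Lemma graph_funP G x : graph_dom G x -> G (x, graph_fun G x).
Proof. exact: xgetPex. Qed.

Lemma graph_funE G x y : hom_graph G -> G (x, y) -> graph_fun G x = y.
Proof.
move=> [_ GB _ _ G0] Gxy; apply/eqP; rewrite -subr_eq0; apply/eqP/G0.
by rewrite -(subrr x); apply: GB => //; apply: graph_funP; exists y.
Qed.

Lemma graph_dom_subfield G : hom_graph G -> is_subfield (graph_dom G).
Proof.
move=> [G1 GB GM GV _]; split.
- by rewrite inE; exists 1.
- move=> x y; rewrite !inE => -[x' hx] [y' hy]; exists (x' - y'); exact: GB.
- move=> x y; rewrite !inE => -[x' hx] [y' hy]; exists (x' * y'^-1).
  by apply: GM => //; exact: GV.
Qed.

Lemma graph_opp G x y : hom_graph G -> G (x, y) -> G (- x, - y).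
Proof.
move=> [_ GB _ _ _] h; have h0 := GB _ _ _ _ h h; rewrite !subrr in h0.
by have := GB _ _ _ _ h0 h; rewrite !sub0r.
Qed.

Lemma graph_fun_hom G : hom_graph G -> is_hom (graph_dom G) (graph_fun G).
Proof.
move=> hG; have [G1 GB GM GV G0] := hG; split; first exact: graph_funE.
- move=> x y /graph_funP hx /graph_funP hy; apply: graph_funE => //.
  have := GB _ _ _ _ hx (graph_opp hG hy); by rewrite !opprK.
- by move=> x y /graph_funP hx /graph_funP hy; apply: graph_funE => //; exact: GM.
Qed.

(** The graph of the homomorphism F(x) -> C that extends s and sends x to r,
    for r a root of the image under s of the minimal polynomial of x. *)
Definition adjoin_graph (F : fieldType) (iota s : {rmorphism F -> C}) (x r : C) :
    set (C * C) :=
  [set w | exists q : {poly F}, w = ((map_poly iota q).[x], (map_poly s q).[r])].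

(** If a polynomial vanishes at x then p divides it, so its image under s vanishes
    at r: this is functionality.  Otherwise it is coprime to p, and a Bezout
    relation evaluated at x and at r provides the two inverses. *)
Lemma adjoin_graph_hom (F : fieldType) (iota s : {rmorphism F -> C}) x r p :
  minimal_over iota x p -> root (map_poly s p) r ->
  hom_graph (adjoin_graph iota s x r).
Proof.
move=> pmin pr; have [_ px pdvd] := pmin.
have eq0 (q : {poly F}) : (map_poly iota q).[x] = 0 -> (map_poly s q).[r] = 0.
  move=> /eqP /pdvd /dvdpP [k ->].
  by rewrite rmorphM hornerM (rootP pr) mulr0.
split.
- by exists 1; rewrite !rmorph1 !hornerC.
- by move=> _ _ _ _ [q [-> ->]] [q' [-> ->]]; exists (q - q');
    rewrite !rmorphB !hornerE.
- by move=> _ _ _ _ [q [-> ->]] [q' [-> ->]]; exists (q * q');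
    rewrite !rmorphM !hornerM.
- move=> _ _ [q [-> ->]]; have [q0|qn0] := eqVneq (map_poly iota q).[x] 0.
    by exists 0; rewrite q0 (eq0 _ q0) invr0 !rmorph0 !horner0.
  have /Bezout_eq1_coprimepP [[u v] /= uv] : coprimep p q by exact: minimal_coprime pmin _.
  have hx : (map_poly iota v).[x] * (map_poly iota q).[x] = 1.
    have := congr1 (fun t => (map_poly iota t).[x]) uv.
    by rewrite rmorphD !rmorphM hornerD !hornerM (rootP px) mulr0 add0r rmorph1 hornerC.
  have hr : (map_poly s v).[r] * (map_poly s q).[r] = 1.
    have := congr1 (fun t => (map_poly s t).[r]) uv.
    by rewrite rmorphD !rmorphM hornerD !hornerM (rootP pr) mulr0 add0r rmorph1 hornerC.
  have inv_of (a b : C) : a * b = 1 -> b^-1 = a.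
    move=> ab; have bn0 : b != 0.
      by apply: contra_eq_neq ab => ->; rewrite mulr0 eq_sym oner_eq0.
    by apply: (mulIf bn0); rewrite mulVf.
  by exists v; rewrite (inv_of _ _ hx) (inv_of _ _ hr).
- by move=> y [q [e ->]]; apply: eq0.
Qed.

(** Clearing denominators gives an integer polynomial vanishing at x, and this can
    be read in any field embedded in C. *)
Lemma algebraic_comp (F : fieldType) (iota : {rmorphism F -> C}) x :
  algebraicOver (ratr : rat -> C) x -> algebraicOver iota x.
Proof.
move=> [p pn0 px]; have [q [a an0 pE]] := rat_poly_scale p.
have qn0 : q != 0.
  by apply: contraNneq pn0 => q0; rewrite pE q0 rmorph0 scaler0.
exists (map_poly intr q).
  have injz : injective (intr : int -> F).
    move=> m n /(congr1 iota); rewrite !rmorph_int; exact: intr_inj.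
  rewrite -size_poly_eq0 size_map_inj_poly ?size_poly_eq0 //.
move: px; rewrite pE map_polyZ rootZ ?fmorph_eq0 ?invr_eq0 ?intr_eq0 //.
rewrite -!map_poly_comp /=.
rewrite (@eq_map_poly _ _ _ (intr : int -> C)); last by move=> z; rewrite /= ratr_int.
rewrite (@eq_map_poly _ _ (iota \o _) (intr : int -> C)) //.
by move=> z; rewrite /= rmorph_int.
Qed.

(** A maximal graph containing G0 has every algebraic number x in its domain:
    x is algebraic over that domain, and as C is algebraically closed the image
    of its minimal polynomial has a root, to which x can be sent. *)
Lemma hom_graph_extend (G0 : set (C * C)) : hom_graph G0 ->
  exists G, [/\ hom_graph G, G0 `<=` G
    & forall x, algebraicOver (ratr : rat -> C) x -> graph_dom G x].
Proof.
move=> hG0.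
(* adding G0 to each member makes the empty chain harmless *)
pose P G := hom_graph (G0 `|` G).
have [G [PG Gmax]] : exists A, P A /\ forall B, A `<` B -> ~ P B.
  apply: Zorn_bigcup => FF FP tot; rewrite /P.
  have both X Y w w' : FF X -> FF Y -> (G0 `|` X) w -> (G0 `|` Y) w' ->
      exists2 Z, FF Z & (G0 `|` Z) w /\ (G0 `|` Z) w'.
    move=> FX FY hX hY; have [XY|YX] := tot _ _ FX FY.
      by exists Y => //; split=> //; case: hX => [?|/XY ?]; [left|right].
    by exists X => //; split=> //; case: hY => [?|/YX ?]; [left|right].
  have [F0|[X0 FX0]] : FF = set0 \/ exists X, FF X.
    by have [->|/set0P] := eqVneq FF set0; [left|right].
    by rewrite F0 bigcup_set0 setU0.
  have up X w : FF X -> (G0 `|` X) w -> (G0 `|` \bigcup_(X in FF) X) w.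
    by move=> FX [?|?]; [left|right; exists X].
  have down w : (G0 `|` \bigcup_(X in FF) X) w -> exists2 X, FF X & (G0 `|` X) w.
    by move=> [?|[X FX ?]]; [exists X0 => //; left|exists X => //; right].
  have bin w w' : (G0 `|` \bigcup_(X in FF) X) w -> (G0 `|` \bigcup_(X in FF) X) w' ->
      exists2 Z, FF Z & (G0 `|` Z) w /\ (G0 `|` Z) w'.
    by move=> /down [X FX hX] /down [Y FY hY]; exact: both hX hY.
  split.
  - by apply: (up _ _ FX0); case: (FP _ FX0).
  - move=> x y x' y' h h'; have [Z FZ [hZ hZ']] := bin _ _ h h'.
    by apply: (up _ _ FZ); case: (FP _ FZ) => _ GB _ _ _; exact: GB.
  - move=> x y x' y' h h'; have [Z FZ [hZ hZ']] := bin _ _ h h'.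
    by apply: (up _ _ FZ); case: (FP _ FZ) => _ _ GM _ _; exact: GM.
  - move=> x y /down [Z FZ hZ].
    by apply: (up _ _ FZ); case: (FP _ FZ) => _ _ _ GV _; exact: GV.
  - by move=> y /down [Z FZ hZ]; case: (FP _ FZ) => _ _ _ _; apply.
exists (G0 `|` G); split; [exact: PG|by move=> w; left|].
set H := G0 `|` G in PG *; move=> x algx.
have [F [iota KE]] := subfield_range (graph_dom_subfield PG).
have [s sE] := hom_rmorphism KE (graph_fun_hom PG).
have [p pmin] := minimal_exists (algebraic_comp iota algx).
have [r pr] : exists r, root (map_poly s p) r.
  apply/closed_rootP; rewrite size_map_poly; have [pm px _] := pmin.
  have := root_size_gt1 _ px; rewrite map_poly_eq0 size_map_poly => /(_ (monic_neq0 pm)).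
  by case: (size p) => [|[|]].
pose G' := adjoin_graph iota s x r.
have hG' : hom_graph G' := adjoin_graph_hom pmin pr.
have HG' : H `<=` G'.
  move=> [a b] hab; have : graph_dom H a by exists b.
  move=> /(range_lift KE) [c ca]; exists c%:P.
  by rewrite !map_polyC !hornerC /= sE ca (graph_funE PG hab).
have GG' : G `<=` G' by move=> w hw; apply: HG'; right.
have [eqG|neqG] := pselect (G' `<=` G); last first.
  exfalso; apply: (Gmax G'); first by split.
  by rewrite /P (_ : G0 `|` G' = G') //; apply/setUidPr => w hw; apply: HG'; left.
exists r; right; apply: eqG; exists 'X.
by rewrite !map_polyX !hornerX.
Qed.

End HomGraph.

(** * Houses and conjugates *)

Section House.
Variable R : realType.
Local Notation C := R[i]%C.
Import Normc.

(** Ring morphisms out of F all agree on polynomials with integer coefficients,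
    hence preserve the roots of rational ones. *)
Lemma root_ratr_hom (F : fieldType) (f g : {rmorphism F -> C}) (p : {poly rat}) a :
  root (map_poly ratr p) (f a) -> root (map_poly ratr p) (g a).
Proof.
have [q [c cn0 ->]] := rat_poly_scale p.
have toint (h : {rmorphism F -> C}) :
    root (map_poly ratr (c%:~R^-1 *: map_poly intr q)) (h a)
    = root (map_poly (intr : int -> F) q) a.
  rewrite map_polyZ rootZ ?fmorph_eq0 ?invr_eq0 ?intr_eq0 // -(fmorph_root h).
  rewrite -!map_poly_comp; congr (root _ _); apply: eq_map_poly => z /=.
  by rewrite ratr_int rmorph_int.
by rewrite !toint.
Qed.

(** The conjugates are finitely many, so the supremum that defines the house is an
    upper bound. *)
Lemma house_ge (p : {poly rat}) (x y : C) : minimal_over (ratr : rat -> C) x p ->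
  root (map_poly ratr p) y -> normc y <= house x.
Proof.
move=> pmin py; rewrite /house.
rewrite (@minpoly_range _ _ (ratr : {rmorphism rat -> C}) _ _ p) //.
apply: ub_le_sup; last by exists y.
have [rs pE] := closed_field_poly_normal (map_poly (ratr : rat -> C) p).
have [pm _ _] := pmin.
exists (\sum_(z <- rs) normc z) => _ [z /= pz <-].
have zrs : z \in rs.
  move: pz; rewrite pE rootZ ?root_prod_XsubC // lead_coef_eq0 map_poly_eq0.
  exact: monic_neq0.
rewrite (perm_big _ (perm_to_rem zrs)) big_cons lerDl.
by apply: sumr_ge0 => t _; exact: normc_ge0.
Qed.

(** Homomorphisms send x to one of its conjugates over the rationals. *)
Lemma house_ge_hom (K : set C) (s : C -> C) x : is_subfield K -> is_hom K s ->
  K x -> algebraicOver (ratr : rat -> C) x -> normc (s x) <= house x.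
Proof.
move=> subK hs Kx algx; have [p pmin] := minimal_exists algx.
apply: (house_ge pmin).
have [F [iota KE]] := subfield_range subK.
have [f fE] := hom_rmorphism KE hs.
have [a aE] := range_lift KE Kx.
rewrite -aE -fE; apply: (@root_ratr_hom _ iota f).
by rewrite aE; case: pmin.
Qed.

Lemma alg_integer_algebraic (x : C) : alg_integer x -> algebraicOver (ratr : rat -> C) x.
Proof.
move=> [p pm px]; exists (map_poly intr p).
  by rewrite monic_neq0 // monic_map.
rewrite -map_poly_comp (@eq_map_poly _ _ _ (intr : int -> C)) //.
by move=> z; rewrite /= ratr_int.
Qed.

(** By the lemma of Gauss the minimal polynomial of x over the rationals is, up to
    a scalar, an integer polynomial p1 with leading coefficient 1 or -1.  Its
    constant term is nonzero since x is, and up to sign it is the product of the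
    conjugates; as this product has modulus at least 1, so has one of them. *)
Lemma conjugate_ge1 (x : C) : alg_integer x -> x != 0 ->
  exists (p : {poly rat}) (y : C),
    [/\ minimal_over (ratr : rat -> C) x p, root (map_poly ratr p) y
    & 1 <= normc y].
Proof.
move=> xint xn0; have [p pmin] := minimal_exists (alg_integer_algebraic xint).
have [pm px pdvd] := pmin.
have [P Pm Px] := xint.
have pP : p %| map_poly intr P.
  apply: pdvd; rewrite -map_poly_comp (@eq_map_poly _ _ _ (intr : int -> C)) //.
  by move=> z; rewrite /= ratr_int.
have [p1 [a an0 pE] [r PE]] := dvdpP_rat_int pP.
have qE : map_poly (ratr : rat -> C) p = ratr a *: map_poly intr p1.
  rewrite pE map_polyZ -map_poly_comp; congr (_ *: _); apply: eq_map_poly => z /=.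
  by rewrite ratr_int.
have ran0 : (ratr a : C) != 0 by rewrite fmorph_eq0.
have lc1 : normc ((lead_coef p1)%:~R : C) = 1.
  have := monicP Pm; rewrite PE lead_coefM => h.
  have : lead_coef p1 \is a GRing.unit by apply/unitrP; exists (lead_coef r); rewrite mulrC h.
  case/orP => /eqP ->; first exact: normc1.
  by rewrite mulrN1z normcN normc1.
(* otherwise 'X divides p, and x is a root of the cofactor *)
have c0 : p1`_0 != 0.
  apply: contraNneq xn0 => c0.
  have : root p 0 by rewrite pE rootZ // rootE horner_coef0 coef_map c0.
  move=> /factor_theorem [k]; rewrite polyC0 subr0 => kE.
  have kn0 : k != 0 by apply: contraTneq (monic_neq0 pm) => k0; rewrite kE k0 mul0r eqxx.
  have : root (map_poly ratr k) x || (x == 0).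
    by have := px; rewrite kE rmorphM rootM /= map_polyX rootX.
  case/orP => [/pdvd/(dvdp_leq kn0)|//].
  by rewrite kE size_mulX // ltnn.
have c1 : 1 <= normc ((p1`_0)%:~R : C).
  rewrite (_ : normc _ = `|(p1`_0)%:~R|).
    by rewrite -intr_norm ler1z -gtz0_ge1 normr_gt0.
  have -> : ((p1`_0)%:~R : C) = (((p1`_0)%:~R : R)%:C)%C by rewrite rmorph_int.
  by rewrite /= expr0n addr0 sqrtr_sqr.
have [rs rE] := closed_field_poly_normal (map_poly (intr : int -> C) p1).
have lcE : lead_coef (map_poly (intr : int -> C) p1) = (lead_coef p1)%:~R.
  by rewrite lead_coef_map_inj //; exact: intr_inj.
have root_rs y : root (map_poly ratr p) y = (y \in rs).
  rewrite qE rootZ // rE rootZ ?root_prod_XsubC // lcE intr_eq0 lead_coef_eq0.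
  by apply: contraNneq c0 => ->; rewrite coef0.
have prodE : normc ((p1`_0)%:~R : C) = \prod_(z <- rs) normc z.
  have -> : (p1`_0)%:~R = (map_poly (intr : int -> C) p1).[0].
    by rewrite horner_coef0 coef_map.
  rewrite rE hornerZ normcM lcE lc1 mul1r horner_prod.
  elim: (rs) => [|z l IH]; first by rewrite !big_nil; exact: normc1.
  by rewrite !big_cons normcM IH !hornerE normcN.
have [y ys y1] : exists2 y, y \in rs & 1 <= normc y.
  have := px; rewrite root_rs => xrs.
  apply: contrapT => nex.
  have lt1 y : y \in rs -> normc y < 1.
    by move=> yrs; rewrite ltNge; apply/negP => h; apply: nex; exists y.
  move: c1; rewrite prodE (perm_big _ (perm_to_rem xrs)) big_cons leNgt => /negP; apply.
  have le1 : \prod_(z <- rem x rs) normc z <= 1.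
    rewrite big_seq; apply: prodr_ile1 => z zr.
    by rewrite normc_ge0 ltW // lt1 // (mem_rem zr).
  apply: le_lt_trans (lt1 _ xrs).
  by rewrite ler_piMr ?normc_ge0.
by exists p, y; split=> //; rewrite root_rs.
Qed.

End House.

(** * Subrings of C *)

Section Subrings.
Variable R : realType.
Local Notation C := R[i]%C.
Implicit Types A K : set C.

Lemma subringP A : is_subring A ->
  [/\ A 1, forall x y, A x -> A y -> A (x - y)
    & forall x y, A x -> A y -> A (x * y)].
Proof.
move=> [A1 AB AM]; split; first by move: A1; rewrite inE.
- by move=> x y /mem_set xA /mem_set yA; apply: set_mem; exact: AB.
- by move=> x y /mem_set xA /mem_set yA; apply: set_mem; exact: AM.
Qed.

Lemma subring0 A : is_subring A -> A 0.
Proof. by move=> /subringP [A1 AB _]; rewrite -(subrr 1); exact: AB. Qed.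

Lemma subringD A x y : is_subring A -> A x -> A y -> A (x + y).
Proof.
move=> rA Ax Ay; have [_ AB _] := subringP rA.
by rewrite -[y]opprK -[- y]sub0r; apply: (AB) => //; apply: (AB) => //; exact: subring0.
Qed.

Lemma subfield_subring K : is_subfield K -> is_subring K.
Proof. exact: GRing.divring_closedBM. Qed.

Lemma subring_horner A (p : {poly C}) x : is_subring A ->
  (forall i, A p`_i) -> A x -> A p.[x].
Proof.
move=> rA pA Ax; rewrite horner_coef; have [A1 _ AM] := subringP rA.
apply: (big_ind A); [exact: subring0|by move=> *; exact: subringD|move=> i _].
apply: (AM) => //; elim: (nat_of_ord i) => [|n IH]; first by rewrite expr0.
by rewrite exprS; exact: AM.
Qed.

Lemma smallest_subring (S : set C) : is_subring (smallest (@is_subring R) S).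
Proof.
split.
- by apply: mem_set => B [/subringP [B1 _ _] _].
- move=> x y /set_mem xA /set_mem yA; apply: mem_set => B hB.
  by have [/subringP [_ BB _] _] := hB; apply: BB; [exact: xA|exact: yA].
- move=> x y /set_mem xA /set_mem yA; apply: mem_set => B hB.
  by have [/subringP [_ _ BM] _] := hB; apply: BM; [exact: xA|exact: yA].
Qed.

Lemma alg_integer_subring : is_subring (@alg_integer R).
Proof.
split; first by apply: mem_set; exact: integral1.
- by move=> x y /set_mem hx /set_mem hy; apply: mem_set; exact: integral_sub.
- by move=> x y /set_mem hx /set_mem hy; apply: mem_set; exact: integral_mul.
Qed.

Lemma fracs_subfield A : is_subring A -> is_subfield (fracs A).
Proof.
move=> rA; have [A1 AB AM] := subringP rA; split.
- by apply: mem_set; exists 1, 1; rewrite divr1 oner_eq0.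
- move=> _ _ /set_mem [a [b [Aa Ab bn0 ->]]] /set_mem [c [e [Ac Ae en0 ->]]].
  apply: mem_set; exists (a * e - c * b), (b * e); split; first by apply: AB; exact: AM.
  + exact: AM.
  + by rewrite mulf_neq0.
  + by field; rewrite bn0 en0.
- move=> _ _ /set_mem [a [b [Aa Ab bn0 ->]]] /set_mem [c [e [Ac Ae en0 ->]]].
  apply: mem_set; have [->|cn0] := eqVneq c 0.
    exists 0, 1; rewrite oner_eq0 !mul0r invr0 mulr0; split=> //; exact: subring0.
  exists (a * e), (b * c); split; [exact: AM|exact: AM|by rewrite mulf_neq0|].
  by field; rewrite cn0 bn0 en0.
Qed.

Lemma sub_fracs A : is_subring A -> A `<=` fracs A.
Proof.
move=> /subringP [A1 _ _] a Aa; exists a, 1; by rewrite divr1 oner_eq0.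
Qed.

Section SubringType.
Variables (A : set C) (subA : is_subring A).

Definition subring_pred (_ : is_subring A) : {pred C} := ([in A]).

HB.instance Definition _ :=
  GRing.isSubringClosed.Build _ (subring_pred subA) subA.

Record subring_type :=
  Subring { subring_val : C; _ : subring_val \in subring_pred subA }.

HB.instance Definition _ := [isSub for subring_val].
HB.instance Definition _ := [Choice of subring_type by <:].
HB.instance Definition _ := [SubChoice_isSubComNzRing of subring_type by <:].

Lemma subring_range : exists (B : comNzRingType) (iota : {rmorphism B -> C}),
  injective iota /\ A = range iota.
Proof.
exists subring_type, (GRing.RMorphism.clone _ _ (\val : subring_type -> _) _).
split; first exact: val_inj.
apply/seteqP; split=> [y /mem_set Ay|_ [a _ <-]]; first by exists (Subring Ay).
by apply: set_mem; exact: (valP a).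
Qed.

End SubringType.

(** Division by a monic polynomial stays within the ring of coefficients; it is
    carried out over an abstract ring B with range A. *)
Lemma monic_reduction A (M q : {poly C}) x : is_subring A -> M \is monic ->
  M \is a polyOver [in A] -> root M x -> q \is a polyOver [in A] ->
  exists2 r, r \is a polyOver [in A] & (size r < size M)%N /\ q.[x] = r.[x].
Proof.
move=> rA Mm MA Mx qA; have [B [iota [inj AE]]] := subring_range rA.
have [m mE] := polyOver_range AE MA; have [q' qE] := polyOver_range AE qA.
have sz (p : {poly B}) : size (map_poly iota p) = size p.
  by apply: size_map_inj_poly => //; exact: rmorph0.
have mm : m \is monic.
  move: Mm; rewrite !monicE mE lead_coef_map_inj ?rmorph0 //.
  by rewrite -[X in _ == X](rmorph1 iota) => /eqP /inj ->.
exists (map_poly iota (Pdiv.Ring.rmodp q' m)).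
  apply/polyOver_setP; first exact: subring0.
  by move=> i; rewrite coef_map AE; exists (Pdiv.Ring.rmodp q' m)`_i.
split; first by rewrite mE !sz Pdiv.Ring.ltn_rmodp // monic_neq0.
rewrite qE {1}(Pdiv.RingMonic.rdivp_eq mm q') rmorphD rmorphM hornerD hornerM.
by rewrite /= -mE (rootP Mx) mulr0 add0r.
Qed.

End Subrings.

(** * Simple extensions and their embeddings *)

Section Enumeration.
Variables (R : realType) (F : fieldType).
Local Notation C := R[i]%C.
Variables (iota : {rmorphism F -> C}) (K : set C) (x : C) (p : {poly F}).
Hypotheses (KE : K = range iota) (pmin : minimal_over iota x p).
Local Notation L := (field_adjoin K x).

(** Since x is algebraic over K, the polynomial expressions in x already form a
    field; they are the domain of the graph of the identity of K(x). *)
Lemma field_adjoinE : L = graph_dom (adjoin_graph iota iota x x).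
Proof.
have px : root (map_poly iota p) x by case: pmin.
apply/seteqP; split.
  apply: smallest_sub.
    exact/graph_dom_subfield/(adjoin_graph_hom pmin).
  move=> y [/(range_lift KE) [a <-]|->].
    by exists (iota a), a%:P; rewrite map_polyC hornerC.
  by exists x, 'X; rewrite map_polyX hornerX.
move=> y [_ [q [-> _]]] B [subB KxB].
apply: subring_horner; first exact: subfield_subring.
  by move=> i; apply: KxB; left; rewrite coef_map; exact: in_range.
by apply: KxB; right.
Qed.

Lemma field_adjoin_subfield : is_subfield L.
Proof.
have [_ px _] := pmin; rewrite field_adjoinE.
exact/graph_dom_subfield/(adjoin_graph_hom pmin).
Qed.

Lemma field_adjoin_horner q : L (map_poly iota q).[x].
Proof. by rewrite field_adjoinE; exists (map_poly iota q).[x], q. Qed.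

(** Independence is the minimality of p, and generation is reduction modulo p. *)
Lemma powers_basis n : n = (size p).-1 -> is_basis K L (fun j : 'I_n => x ^+ j).
Proof.
move=> nE; have [pm px pdvd] := pmin; have pn0 := monic_neq0 pm.
have sp : size p = n.+1 by rewrite nE prednK // size_poly_gt0.
split=> [i|c cK c0 i|y].
- by have := field_adjoin_horner 'X^i; rewrite map_polyXn hornerXn.
- have /choice [a aE] := fun i => range_lift KE (cK i).
  pose q := \sum_(j < n) a j *: 'X^j.
  have : p %| q.
    apply: pdvd; rewrite rootE /q rmorph_sum horner_sum -[X in _ == X]c0; apply/eqP.
    apply: eq_bigr => j _; by rewrite /= map_polyZ map_polyXn hornerZ hornerXn aE.
  have qc (j : 'I_n) : q`_j = a j.
    rewrite /q coef_sum (bigD1 j) //= coefZ coefXn eqxx mulr1 big1 ?addr0 // => k nkj.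
    by rewrite coefZ coefXn eq_sym (inj_eq val_inj) (negbTE nkj) mulr0.
  have sq : (size q <= n)%N.
    apply: (leq_trans (size_sum _ _ _)); apply/bigmax_leqP => j _.
    by apply: leq_trans (size_scale_leq _ _) _; rewrite size_polyXn.
  have [q0|qn0] := eqVneq q 0; first by rewrite -aE -qc q0 coef0 rmorph0.
  by move=> /(dvdp_leq qn0); rewrite sp => /leq_trans /(_ sq); rewrite ltnn.
- rewrite field_adjoinE => -[_ [q [-> _]]].
  exists (fun j : 'I_n => iota (q %% p)`_j) => [j|]; first exact: in_range.
  rewrite {1}(divp_eq q p) rmorphD rmorphM hornerD hornerM (rootP px) mulr0 add0r.
  rewrite (@horner_coef_wide _ n); last by rewrite size_map_poly -ltnS -sp ltn_modp.
  by apply: eq_bigr => j _; rewrite coef_map.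
Qed.

Lemma ext_degree_minimal : ext_degree K L = (size p).-1.
Proof. exact: (ext_degreeE KE (powers_basis _)). Qed.

Section Extensions.
Variables (s : C -> C) (f : {rmorphism F -> C}).
Hypothesis fE : forall a, f a = s (iota a).

Lemma extends_horner u q : extends K L s u ->
  u (map_poly iota q).[x] = (map_poly f q).[u x].
Proof.
move=> [[u1 uD uM] us].
have Lx : L x by have := field_adjoin_horner 'X; rewrite map_polyX hornerX.
have L0 : L 0 by exact: (subring0 (subfield_subring field_adjoin_subfield)).
have u0 : u 0 = 0 by apply: (addrI (u 0)); rewrite -uD ?addr0.
elim/poly_ind: q => [|q c IH]; first by rewrite !rmorph0 !horner0.
rewrite !rmorphD !rmorphM /= !map_polyX !map_polyC /= !hornerMXaddC.
have Lq := field_adjoin_horner q.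
have Lc : L (iota c) by have := field_adjoin_horner c%:P; rewrite map_polyC hornerC.
have [_ _ LM] := subringP (subfield_subring field_adjoin_subfield).
have Lqx := LM _ _ Lq Lx.
by rewrite (uD _ _ Lqx Lc) (uM _ _ Lq Lx) IH (us _ (in_range KE c)) -fE.
Qed.

(** An extension of s is determined by the image of x, which is a root of the image
    of p under s, and each root occurs.  By separability these roots are as many
    as the degree of p. *)
Lemma enumerate_extensions n : n = (size p).-1 ->
  exists t : 'I_n -> C -> C,
    enum_extensions K L s t /\ injective (fun i => t i x).
Proof.
move=> nE; have [pm px _] := pmin; have pn0 := monic_neq0 pm.
have [rs rE] := closed_field_poly_normal (map_poly f p).
have lc1 : lead_coef (map_poly f p) = 1 by rewrite lead_coef_map (monicP pm) rmorph1.
rewrite lc1 scale1r in rE.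
have srs : size rs = n.
  by rewrite nE -(size_map_poly f) rE size_prod_XsubC.
have urs : uniq rs.
  rewrite -separable_prod_XsubC -rE separable_map.
  exact: minimal_separable (range_char0 iota) pmin.
have root_rs y : root (map_poly f p) y = (y \in rs) by rewrite rE root_prod_XsubC.
pose r (i : 'I_n) := rs`_i.
have rr i : root (map_poly f p) (r i) by rewrite root_rs mem_nth // srs.
pose G i := adjoin_graph iota f x (r i).
have hG i : hom_graph (G i) by exact: adjoin_graph_hom pmin (rr i).
have domG i : graph_dom (G i) = L.
  rewrite field_adjoinE; apply/seteqP.
  by split=> y [_ [q [-> _]]]; eexists; exists q.
have tG i q : graph_fun (G i) (map_poly iota q).[x] = (map_poly f q).[r i].
  by apply: graph_funE => //; exists q.
have tx i : graph_fun (G i) x = r i.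
  by have := tG i 'X; rewrite !map_polyX !hornerX.
have text i : extends K L s (graph_fun (G i)).
  split; first by rewrite -(domG i); exact: graph_fun_hom.
  move=> _ /(range_lift KE) [a <-]; have := tG i a%:P.
  by rewrite !map_polyC !hornerC /= fE.
have rinj : injective r.
  by move=> i j /eqP; rewrite nth_uniq ?srs // => /eqP /val_inj.
have Lx : L x by have := field_adjoin_horner 'X; rewrite map_polyX hornerX.
exists (fun i => graph_fun (G i)); split; last by move=> i j; rewrite !tx => /rinj.
split=> //.
  by move=> i j /(_ _ Lx); rewrite !tx => /rinj.
move=> u uext.
have : root (map_poly f p) (u x).
  rewrite rootE -(extends_horner p uext) (rootP px).
  by have := extends_horner 0 uext; rewrite !rmorph0 !horner0 => ->.
rewrite root_rs => uxrs; have lt_i : (index (u x) rs < n)%N by rewrite -srs index_mem.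
exists (Ordinal lt_i); rewrite field_adjoinE => y [_ [q [-> _]]].
rewrite (extends_horner q uext) (extends_horner q (text _)) tx.
by rewrite /r /= nth_index.
Qed.

End Extensions.
End Enumeration.

(** * The house of a new element *)

Section OneStep.
Variables (R : realType) (A : set R[i]%C) (x : R[i]%C).
Local Notation C := R[i]%C.
Local Notation K := (fracs A).
Local Notation L := (field_adjoin K x).
Local Notation d := (ext_degree K L).
Import Normc.
Hypotheses (rA : is_subring A) (Aint : forall a, A a -> alg_integer a).
Hypotheses (x_int : alg_integer x) (d_gt1 : (1 < d)%N).

Lemma fracs_algebraic y : K y -> algebraicOver (ratr : rat -> C) y.
Proof.
by move=> [a [b [/Aint/alg_integer_algebraic aa /Aint/alg_integer_algebraic ba _ ->]]];
  exact: algebraic_div.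
Qed.

(** Send c to a conjugate of modulus at least 1 and extend the homomorphism from the
    field generated by c to all algebraic numbers, hence to K. *)
Lemma hom_conjugate_ge1 c : A c -> c != 0 ->
  exists2 s, is_hom K s & 1 <= normc (s c).
Proof.
move=> Ac cn0; have [p [y [pmin py y1]]] := conjugate_ge1 (Aint Ac) cn0.
have [G [hG sG algG]] := hom_graph_extend (adjoin_graph_hom pmin py).
have [h1 hD hM] := graph_fun_hom hG.
have KG z : K z -> graph_dom G z by move=> /fracs_algebraic /algG.
exists (graph_fun G).
  split=> //; first by move=> a b /KG Ga /KG Gb; exact: hD.
  by move=> a b /KG Ga /KG Gb; exact: hM.
rewrite (@graph_funE _ _ c y) //; apply: sG; exists 'X.
by rewrite !map_polyX !hornerX.
Qed.

(** The infimum that defines eta is bounded by its term at an embedding s for which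
    s (a m) has modulus at least 1. *)
Lemma eta_house_le_house (a : 'I_d -> C) (m : 'I_d) :
  (forall k, A (a k)) -> (0 < m)%N -> a m != 0 ->
  (eta_house K x <= (house (\sum_(k < d) a k * x ^+ k))%:E)%E.
Proof.
move=> aA m0 am0; set beta := \sum_(k < d) _.
have [s hs sam] := hom_conjugate_ge1 (aA m) am0.
have [F [iota KE]] := subfield_range (fracs_subfield rA).
have algx : algebraicOver (ratr : rat -> C) x := alg_integer_algebraic x_int.
have [p pmin] := minimal_exists (algebraic_comp iota algx).
have [f fE] := hom_rmorphism KE hs.
have [t [tenum tinj]] := enumerate_extensions KE pmin fE (ext_degree_minimal KE pmin).
have [text _ _] := tenum.
have /choice [c cE] : forall k, exists b, iota b = a k.
  by move=> k; apply: (range_lift KE); exact: sub_fracs.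
pose q := \sum_(k < d) c k *: 'X^k.
have horner_q (g : {rmorphism F -> C}) z :
    (map_poly g q).[z] = \sum_(k < d) g (c k) * z ^+ k.
  rewrite /q rmorph_sum horner_sum; apply: eq_bigr => k _.
  by rewrite /= map_polyZ map_polyXn hornerZ hornerXn.
have betaE : beta = (map_poly iota q).[x].
  by rewrite horner_q; apply: eq_bigr => k _; rewrite cE.
(* the d > 1 values at x are distinct, so one of them is nonzero *)
have supp : 0 < supnorm (fun i => t i x).
  pose i0 := Ordinal (ltnW d_gt1); pose i1 := Ordinal d_gt1.
  have [i tn0] : exists i, t i x != 0.
    have [t0|?] := eqVneq (t i0 x) 0; last by exists i0.
    exists i1; apply/eqP => t1.
    by have /(congr1 val) := tinj i0 i1 (etrans t0 (esym t1)).
  by apply: lt_le_trans (supnorm_ge _ i); exact: normc_gt0.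
have [i ti] := @eta_term_le_value _ d (fun i => t i x) (fun k => s (a k)) m supp m0 sam.
apply: (@le_trans _ _ (eta_term (fun i => t i x))%:E).
  by apply: ereal_inf_lbound; exists s, t; split.
rewrite lee_fin; apply: le_trans ti _.
have -> : \sum_(k < d) s (a k) * t i x ^+ k = t i beta.
  rewrite betaE (extends_horner KE pmin fE q (text i)) horner_q.
  by apply: eq_bigr => k _; rewrite fE cE.
have [thom _] := text i.
apply: (house_ge_hom (field_adjoin_subfield KE pmin) thom).
  by rewrite betaE; exact: field_adjoin_horner KE pmin _.
apply: alg_integer_algebraic.
have [_ _ IM] := subringP (@alg_integer_subring R).
apply: (big_ind (@alg_integer R)); first exact: (subring0 (@alg_integer_subring R)).
  by move=> u v; exact: (subringD (@alg_integer_subring R)).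
move=> k _; apply: (IM); first exact/Aint.
elim: (nat_of_ord k) => [|n IH]; first by rewrite expr0; exact: integral1.
by rewrite exprS; exact: IM.
Qed.

Hypothesis minpolyA : minpoly K x \is a polyOver [in A].

(** Each element of A[x] is a polynomial in x of degree less than d with
    coefficients in A; if all the coefficients of positive index vanished,
    it would belong to A. *)
Lemma eta_house_le_house_adjoin beta : ring_adjoin A [set x] beta -> ~ A beta ->
  (eta_house K x <= (house beta)%:E)%E.
Proof.
move=> beta_in betaA.
have [F [iota KE]] := subfield_range (fracs_subfield rA).
have algx : algebraicOver (ratr : rat -> C) x := alg_integer_algebraic x_int.
have [p pmin] := minimal_exists (algebraic_comp iota algx).
have [pm px _] := pmin.
have ME := minpoly_range KE pmin.
have dE : size (map_poly iota p) = d.+1.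
  by rewrite size_map_poly (ext_degree_minimal KE pmin) prednK // size_poly_gt0 monic_neq0.
have [A1 AB AM] := subringP rA.
have A0 := subring0 rA.
have Mm : minpoly K x \is monic by rewrite ME map_monic.
have Mx : root (minpoly K x) x by rewrite ME.
have [q qA qE] : exists2 q : {poly C}, q \is a polyOver [in A] & beta = q.[x].
  pose P : set C := [set y | exists2 q : {poly C}, forall i, A q`_i & y = q.[x]].
  have [q qA qE] : P beta.
    apply: beta_in; split.
      split.
      - apply: mem_set; exists 1; rewrite ?hornerC // => i.
        by rewrite coef1; case: eqP.
      - move=> _ _ /set_mem [q qA ->] /set_mem [r Ar ->]; apply: mem_set.
        by exists (q - r); rewrite ?hornerD ?hornerN // => i; rewrite coefB; exact: AB.
      - move=> _ _ /set_mem [q qA ->] /set_mem [r Ar ->]; apply: mem_set.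
        exists (q * r); rewrite ?hornerM // => i; rewrite coefM.
        apply: (big_ind A) => // [u v|j _]; first exact: subringD.
        exact: AM.
    move=> y [Ay|->]; [exists y%:P|exists 'X]; rewrite ?hornerC ?hornerX // => i.
      by rewrite coefC; case: eqP.
    by rewrite coefX; case: eqP.
  by exists q => //; apply/polyOver_setP.
have [r r_coef [szr rE]] := monic_reduction rA Mm minpolyA Mx qA.
have {}szr : (size r <= d)%N by rewrite -ltnS -dE -ME.
move/(polyOver_setP _ A0): r_coef => r_coef.
have betaE : beta = \sum_(k < d) r`_k * x ^+ k.
  by rewrite qE rE (horner_coef_wide _ szr).
have [m m0 rm] : exists2 m : 'I_d, (0 < m)%N & r`_m != 0.
  apply: contrapT => nex; apply: betaA; rewrite betaE.
  pose i0 := Ordinal (ltnW d_gt1).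
  rewrite (bigD1 i0) //= big1 ?addr0 ?expr0 ?mulr1 // => k nk0.
  have [->|rk] := eqVneq r`_k 0; first by rewrite mul0r.
  by case: nex; exists k => //; rewrite lt0n.
rewrite betaE; exact: (@eta_house_le_house (fun k : 'I_d => r`_k) m).
Qed.

End OneStep.

(** * Towers *)

Section TowerFacts.
Variables (R : realType) (O0 : set R[i]%C) (xi : nat -> R[i]%C).
Hypothesis xi_int : forall i : nat, (1 <= i)%N -> alg_integer (xi i).
Hypothesis O0_int : forall a, O0 a -> alg_integer a.

Lemma tower_subring i : is_subring (tower O0 xi i).
Proof. exact: smallest_subring. Qed.

Lemma tower_le i j : (i <= j)%N -> tower O0 xi i `<=` tower O0 xi j.
Proof.
move=> le_ij; apply: smallest_sub; first exact: tower_subring.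
move=> y hy B [_ sB]; apply: sB.
case: hy => [hy0| [k /= /andP[k1 ki] <-]]; first by left.
by right; exists k => //=; rewrite k1 (leq_trans ki).
Qed.

Lemma tower_alg_integer i a : tower O0 xi i a -> alg_integer a.
Proof.
apply: smallest_sub; first exact: alg_integer_subring.
by move=> y [/O0_int| [k /= /andP[k1 _] <-]] //; exact: xi_int.
Qed.

Lemma tower_succ i : tower O0 xi i.+1 `<=` ring_adjoin (tower O0 xi i) [set xi i.+1].
Proof.
apply: smallest_sub; first exact: smallest_subring.
move=> y hy B [_ sB]; apply: sB.
case: hy => [hy0| [k /= /andP[k1 ki] <-]].
  by left => D [_ sD]; apply: sD; left.
move: ki; rewrite leq_eqVlt => /orP [/eqP ->|ki]; first by right.
by left => D [_ sD]; apply: sD; right; exists k => //=; rewrite k1.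
Qed.

End TowerFacts.

Lemma Nhouse_pinfty_finite (R : realType) (S : set R[i]%C) (X : R) :
  0 <= X -> Nhouse S = +oo%E -> finite_set [set a | S a /\ house a < X].
Proof.
move=> X0 NS; apply: contrapT => Sinf.
have : (Nhouse S <= X%:E)%E by apply: ereal_inf_lbound; exists X.
by rewrite NS leNgt ltry.
Qed.

(** The lower limit is the supremum of the infima of the tails. *)
Lemma lt_limn_einf (R : realType) (u : nat -> \bar R) (x : \bar R) :
  (x < limn_einf u)%E -> exists n, forall m, (n <= m)%N -> (x < u m)%E.
Proof.
rewrite limn_einf_lim (cvg_lim _ (@cvg_einfs_sup R u)) // => /ereal_sup_gt.
move=> [_ [n _ <-] xn]; exists n => m nm.
by apply: lt_le_trans xn _; apply: ereal_inf_lbound; exists m.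
Qed.

Theorem theorem2 (R : realType) (xi : nat -> R[i]%C) (O0 : set R[i]%C)
  (xi_int : forall i : nat, (1 <= i)%N -> alg_integer (xi i))
  (O0_ring : is_subring O0)
  (O0_int : forall a, O0 a -> alg_integer a)
  (Nhouse_oo : forall i : nat, (1 <= i)%N -> Nhouse (tower O0 xi i) = +oo%E)
  (degree_gt1 : forall i : nat, (1 <= i)%N ->
    (1 < ext_degree (tower_field O0 xi i.-1)
           (field_adjoin (tower_field O0 xi i.-1) (xi i)))%N)
  (minpoly_over : forall i : nat, (1 <= i)%N ->
    minpoly (tower_field O0 xi i.-1) (xi i)
      \is a polyOver [in tower O0 xi i.-1]) :
  (limn_einf (fun i => eta_house (tower_field O0 xi i) (xi i.+1))
     <= Nhouse (tower_union O0 xi))%E.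
Proof.
apply: le_ereal_inf_tmp => _ [X [X0 Xinf] <-]; rewrite leNgt; apply/negP.
move=> /lt_limn_einf [n hn]; apply: Xinf.
apply: sub_finite_set (Nhouse_pinfty_finite X0 (Nhouse_oo n.+1 isT)).
move=> a [[j /= j1 aj] aX]; split=> //.
have {j1}aj : tower O0 xi (n.+1 + j) a by apply: tower_le aj; exact: leq_addl.
(* descend to the ring of index n.+1: the last step cannot be new, since
   new elements have house at least eta, which is greater than X *)
elim: j aj => [|j IH] aj; first by rewrite addn0 in aj.
apply: contrapT => an; apply: an; apply: IH; apply: contrapT => an.
have := hn (n.+1 + j)%N (ltnW (leq_addr _ _)); rewrite ltNge => /negP; apply.
apply: (@le_trans _ _ (house a)%:E); last by rewrite lee_fin ltW.
apply: eta_house_le_house_adjoin an => //.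
- exact: tower_subring.
- exact: tower_alg_integer.
- exact: xi_int.
- exact: (degree_gt1 (n.+1 + j).+1).
- exact: (minpoly_over (n.+1 + j).+1).
- by apply: tower_succ; rewrite -addnS.
Qed.
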